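(* Let $\tilde f:\mathbb R^n\to\mathbb R\cup\{\infty\}$ be a proper lower semicontinuous function satisfying the KL inequality with respect to $x^*$ in $B_\delta(x^* )\cap[\tilde f(x^* )<\tilde f<\eta]$ with desingularizing function $\varphi$. Let $a,b>0$ and let $\{x_k\}_{k\ge0}$ be a sequence such that for every $k$ $$\tilde f(x_{k+1})+a\|x_{k+1}-x_k\|^2\le\tilde f(x_k),$$ and such that for every $k$ there is a point $\tilde x_k$ with $\partial\tilde f(\tilde x_k)\neq\emptyset$, $$\tilde f(x_k)-\tilde f(x_{k+1})\ge\frac a{b^2}\,\mathrm{dist}(\partial\tilde f(\tilde x_k),0)^2,\qquad \tilde f(x_{k+1})\le\tilde f(\tilde x_k)\le\tilde f(x_k)-a\|\tilde x_k-x_k\|^2 .$$ Assume that $\tilde f(x^* )\le\tilde f(x_0)<\eta$ and that, for every $k$, $x_k\in B_\delta(x^* )$ implies $\tilde f(x_{k+1})\ge\tilde f(x^* )$. Let $\alpha(t)=\frac b{\sqrt a}\varphi'(t)$ and assume also that $$\frac ba\varphi(\tilde f(x_0)-\tilde f(x^* ))+2\sqrt{\frac{\tilde f(x_0)-\tilde f(x^* )-\sigma_\alpha(\tilde f(x_0)-\tilde f(x^* ))}{a}}+\|x_0-x^*\|<\delta .$$ Then $\{x_k\}\subset B_\delta(x^* )$, $x_k\to\tilde x^*$ for some $\tilde x^*$ with $\tilde f(\tilde x^* )\le\tilde f(x^* )$, and for every $k\ge0$ $$\tilde f(x_k)-\tilde f(x^* )\le\sigma_\alpha^{(k)}(\tilde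 f(x_0)-\tilde f(x^* )),$$ $$\|x_k-\tilde x^*\|\le\sum_{i=k}^\infty\|x_i-x_{i+1}\|\le\frac ba\varphi(\tilde f(x_k)-\tilde f(x^* ))+2\sqrt{\frac{\tilde f(x_k)-\tilde f(x^* )-\sigma_\alpha(\tilde f(x_k)-\tilde f(x^* ))}{a}} .$$
   Context: $B_\delta(x^* )$ is the open Euclidean ball, $[\eta_1<\tilde f<\eta_2]=\{x:\eta_1<\tilde f(x)<\eta_2\}$, and $\partial\tilde f$ is the limiting subdifferential: $z\in\hat\partial\tilde f(x)$ (Fréchet subdifferential) iff $\tilde f(y)\ge\tilde f(x)+\langle z,y-x\rangle+o(\|y-x\|)$, and $\partial\tilde f(x)$ is the set of limits of $z_n\in\hat\partial\tilde f(x_n)$ with $x_n\to x$, $\tilde f(x_n)\to\tilde f(x)$. KL inequality with respect to $x^*$ in $B_\delta(x^* )\cap[\tilde f(x^* )<\tilde f<\eta]$ (where $\tilde f(x^* )$ is finite and $\eta>\tilde f(x^* )$): there is a continuous concave function $\varphi:[0,\eta-\tilde f(x^* ))\to\mathbb R_{\ge0}$ (the desingularizing function) with $\varphi(0)=0$, $\varphi$ of class $C^1$ on $(0,\eta-\tilde f(x^* ))$ and $\varphi'>0$ there, such that $\varphi'(\tilde f(x)-\tilde f(x^* ))\,\mathrm{dist}(\partial\tilde f(x),0)\ge1$ for all $x$ in that set. Worst case sequence. $\alpha$ is a continuous non-increasing function on $[0,\eta-\tilde f(x^* ))$ with values in $\mathbb R_{>0}\cup\{\infty\}$, finite for $t>0$,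 where $\alpha(0)$ is the limit of $\alpha(t)$ as $t\to0^+$. One defines $\sigma_\alpha(t)=\max\{s\in[0,t]:\ 1/\alpha(s)^2\le t-s\}$, with the conventions $1/\infty=0$ and $\max(\emptyset)=0$; $\sigma_\alpha^{(k)}$ is $\sigma_\alpha$ applied $k$ times, $\sigma_\alpha^{(0)}(t)=t$. *)

(* Defs.v *)
From HB Require Import structures.
From mathcomp Require Import all_boot all_order all_algebra.
From mathcomp Require Import all_classical all_reals all_analysis.

Set Implicit Arguments.
Unset Strict Implicit.
Unset Printing Implicit Defensive.

Import Order.TTheory GRing.Theory Num.Theory.
Import numFieldNormedType.Exports.
Local Open Scope classical_set_scope.
Local Open Scope ring_scope.

(* The library norm on 'rV[R]_n is the sup norm, hence this Euclidean one. *)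
Definition edot (R : realType) (n : nat) (u v : 'rV[R]_n) : R :=
  \sum_(i < n) u ord0 i * v ord0 i.

Definition enorm (R : realType) (n : nat) (v : 'rV[R]_n) : R :=
  Num.sqrt (edot v v).

Definition eball (R : realType) (n : nat) (c : 'rV[R]_n) (r : R) :
    set 'rV[R]_n :=
  [set x | enorm (x - c) < r].

Definition proper_function (R : realType) (n : nat) (f : 'rV[R]_n -> \bar R) : Prop :=
  (forall x, f x != -oo%E) /\ (exists x, f x \is a fin_num).

(* Both subdifferentials are empty outside the domain of f; the o(||y - x||)
   term is spelled out with epsilon. *)
Definition frechet_subdiff (R : realType) (n : nat) (f : 'rV[R]_n -> \bar R)
    (x : 'rV[R]_n) : set 'rV[R]_n :=
  [set z | f x \is a fin_num /\
    forall e : R, 0 < e -> \forall y \near x,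
      (f x + (edot z (y - x) - e * enorm (y - x))%:E <= f y)%E].

Definition limiting_subdiff (R : realType) (n : nat) (f : 'rV[R]_n -> \bar R)
    (x : 'rV[R]_n) : set 'rV[R]_n :=
  [set z | f x \is a fin_num /\
    exists u v : nat -> 'rV[R]_n,
      [/\ forall k, frechet_subdiff f (u k) (v k),
          u @ \oo --> x,
          f (u k) @[k --> \oo] --> f x
        & v @ \oo --> z]].

(* dist(A, 0), equal to +oo when A is empty. *)
Definition dist0 (R : realType) (n : nat) (A : set 'rV[R]_n) : \bar R :=
  ereal_inf [set (enorm z)%:E | z in A].

(* phi is a function on [0, r[, with r possibly infinite; its values outside of
   this interval are irrelevant. *)
Definition desingularizing (R : realType) (r : \bar R) (phi : R -> R) : Prop :=
  let D := [set t : R | 0 <= t /\ (t%:E < r)%E] in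
  [/\ forall t, D t -> 0 <= phi t,
      phi 0 = 0,
      {within D, continuous phi},
      convex_function (D : set (convex_lmodType R^o)) (fun t => - phi t)
    & forall t : R, 0 < t -> (t%:E < r)%E ->
        [/\ derivable phi t 1, {for t, continuous (derive1 phi)} & 0 < derive1 phi t]].

(* f x - f x0 as a real number; only used where f x and f x0 are finite. *)
Definition gap (R : realType) (n : nat) (f : 'rV[R]_n -> \bar R)
    (x0 x : 'rV[R]_n) : R :=
  fine (f x - f x0)%E.

Definition KL_inequality (R : realType) (n : nat) (f : 'rV[R]_n -> \bar R)
    (xstar : 'rV[R]_n) (delta : R) (eta : \bar R) (phi : R -> R) : Prop :=
  [/\ f xstar \is a fin_num,
      (f xstar < eta)%E,
      desingularizing (eta - f xstar)%E phi
    & forall x, eball xstar delta x -> (f xstar < f x)%E -> (f x < eta)%E ->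
        (1 <= (derive1 phi (gap f xstar x))%:E * dist0 (limiting_subdiff f x))%E].

(* Greatest element of A; 0 when there is none, in particular for A empty. *)
Definition setmax (R : realType) (A : set R) : R :=
  xget 0 [set s | A s /\ ubound A s].

(* In \bar R, (+oo)^-1 = 0. *)
Definition sigma_wc (R : realType) (alpha : R -> \bar R) (t : R) : R :=
  setmax [set s : R | 0 <= s <= t /\ ((alpha s ^+ 2)^-1 <= (t - s)%:E)%E].

(* alpha(t) = (b / sqrt a) phi'(t) for t > 0, extended to t = 0 by its possibly
   infinite right limit. *)
Definition alpha_KL (R : realType) (a b : R) (phi : R -> R) (t : R) : \bar R :=
  let g := fun s : R => (b / Num.sqrt a * derive1 phi s)%:E in
  if t == 0 then lim (g s @[s --> 0^'+]) else g t.

(* Main.v *)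
Require Import Defs.
From HB Require Import structures.
From mathcomp Require Import all_boot all_order all_algebra.
From mathcomp Require Import all_classical all_reals all_analysis.
From mathcomp Require Import ring lra.
Import Order.TTheory GRing.Theory Num.Theory.
Import numFieldNormedType.Exports.
Local Open Scope classical_set_scope.
Local Open Scope ring_scope.

(** Write r_k = f(x_k) - f(x* ), and let e(t, s) = sqrt ((t - s) / a), so that the
    descent condition reads |x_k - x_(k+1)| <= e(r_k, r_(k+1)). Everything is
    reduced to the real sequence r_k and to one relation between consecutive terms,
    [kl_drop t s]: either s = 0, or 1 <= b phi'(s) e(t, s).

    If r_(k+1) > 0, the KL inequality at the intermediate point y_k, combined with
    the relative error condition, gives
    1 <= phi'(f(y_k) - f(x* )) b e(r_k, r_(k+1)). As phi' is non-increasing and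
    f(y_k) >= f(x_(k+1)), this yields [kl_drop r_k r_(k+1)] ([KL_inequality_drop]).
    On the other hand, for s > 0, 1 <= b phi'(s) e(t, s) is precisely the inequality
    1 / alpha(s)^2 <= t - s that defines sigma_alpha ([alpha_KLE]), whence
    r_(k+1) <= sigma(r_k) ([kl_drop_le_sigma]), and the bound by the iterates of sigma,
    which is monotone.

    The length estimate rests on the tangent inequality of the concave function
    phi, [desingularizing_tangent], used twice.
    - For two consecutive steps u >= v >= w it gives
      2 e(v, w) - e(u, v) <= (b / a) (phi(v) - phi(w)), which telescopes and bounds
      the sum of all e(r_i, r_(i+1)) by (b / a) phi(r_1) + 2 e(r_0, r_1).
    - For s <= sigma(t) it gives
      (b / a) phi(s) + 2 e(t, s) <= (b / a) phi(sigma(t)) + 2 e(t, sigma(t)): the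
      left-hand side increases with s as long as 1 / alpha(s)^2 <= t - s. With
      t = r_0 and s = r_1 <= sigma(r_0) the previous bound becomes the stated one,
      [length_bound], which involves r_0 only.

    The KL inequality is available only inside the ball, so that membership of x_k
    in the ball and the relation [kl_drop] are proved by a simultaneous induction.
    The length bound for k + 1 steps needs [kl_drop] only for the first k of them
    ([sum_steplen_le]); hence it controls the distance to y_k and to x_(k+1) before
    anything is known about the last step. Then x_k has finite length and converges;
    r_k tends to 0, since otherwise phi'(r_k) would stay bounded and the steps
    e(r_k, r_(k+1)) would be bounded below; and lower semicontinuity gives
    f(lim x_k) <= f(x* ). *)

(** * The Euclidean norm of row vectors *)

Lemma edotC {R : realType} {n : nat} (u v : 'rV[R]_n) : edot u v = edot v u.
Proof. by rewrite /edot; apply: eq_bigr => i _; rewrite mulrC. Qed.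

Lemma edotDl {R : realType} {n : nat} (u v w : 'rV[R]_n) :
  edot (u + v) w = edot u w + edot v w.
Proof. by rewrite /edot -big_split; apply: eq_bigr => i _; rewrite mxE mulrDl. Qed.

Lemma edotZl {R : realType} {n : nat} (c : R) (u v : 'rV[R]_n) :
  edot (c *: u) v = c * edot u v.
Proof. by rewrite /edot mulr_sumr; apply: eq_bigr => i _; rewrite mxE mulrA. Qed.

Lemma edot_ge0 {R : realType} {n : nat} (u : 'rV[R]_n) : 0 <= edot u u.
Proof. by apply: sumr_ge0 => i _; rewrite -expr2 sqr_ge0. Qed.

Lemma enorm_ge0 {R : realType} {n : nat} (u : 'rV[R]_n) : 0 <= enorm u.
Proof. exact: sqrtr_ge0. Qed.

Lemma sqr_enorm {R : realType} {n : nat} (u : 'rV[R]_n) : enorm u ^+ 2 = edot u u.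
Proof. by rewrite sqr_sqrtr// edot_ge0. Qed.

Lemma enormN {R : realType} {n : nat} (u : 'rV[R]_n) : enorm (- u) = enorm u.
Proof. by rewrite /enorm -scaleN1r edotZl edotC edotZl mulrA mulN1r opprK mul1r. Qed.

Lemma enormB {R : realType} {n : nat} (u v : 'rV[R]_n) : enorm (u - v) = enorm (v - u).
Proof. by rewrite -enormN opprB. Qed.

Lemma enorm0 {R : realType} {n : nat} : enorm (0 : 'rV[R]_n) = 0.
Proof. by rewrite /enorm -(scale0r 0) edotZl mul0r sqrtr0. Qed.

Lemma le_coord_enorm {R : realType} {n : nat} (u : 'rV[R]_n) (i : 'I_n) :
  `|u ord0 i| <= enorm u.
Proof.
rewrite -sqrtr_sqr ler_wsqrtr// /edot (bigD1 i)//= expr2 lerDl.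
by apply: sumr_ge0 => j _; rewrite -expr2 sqr_ge0.
Qed.

Lemma edot_le {R : realType} {n : nat} (u v : 'rV[R]_n) :
  edot u v <= enorm u * enorm v.
Proof.
have [u0|u0] := eqVneq (enorm u) 0.
  rewrite u0 mul0r /edot big1// => i _.
  have := le_coord_enorm u i; rewrite u0 normr_le0 => /eqP ->.
  by rewrite mul0r.
have [v0|v0] := eqVneq (enorm v) 0.
  rewrite v0 mulr0 /edot big1// => i _.
  have := le_coord_enorm v i; rewrite v0 normr_le0 => /eqP ->.
  by rewrite mulr0.
have pu : 0 < enorm u by rewrite lt_def u0 enorm_ge0.
have pv : 0 < enorm v by rewrite lt_def v0 enorm_ge0.
(* expanding this square gives 2 |u|^2 |v|^2 - 2 |u| |v| (u . v) *)
have := edot_ge0 (enorm v *: u - enorm u *: v).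
rewrite -scaleNr edotDl !edotZl !(edotC _ (_ + _)) !edotDl !edotZl (edotC v u).
rewrite -!sqr_enorm => h.
have puv : 0 < enorm u * enorm v by rewrite mulr_gt0.
rewrite -(ler_pM2l puv) -subr_ge0.
rewrite -(@pmulr_rge0 _ 2)//; apply: le_trans h _.
by rewrite le_eqVlt; apply/orP; left; apply/eqP; ring.
Qed.

Lemma enormD {R : realType} {n : nat} (u v : 'rV[R]_n) :
  enorm (u + v) <= enorm u + enorm v.
Proof.
rewrite -(@ler_pXn2r _ 2)// ?nnegrE ?addr_ge0 ?enorm_ge0//.
rewrite sqr_enorm edotDl !(edotC _ (u + v)) !edotDl (edotC v u) sqrrD -!sqr_enorm.
have := edot_le u v; lra.
Qed.

Lemma enorm_path {R : realType} {n : nat} (x : nat -> 'rV[R]_n) {k m : nat} :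
  (k <= m)%N -> enorm (x k - x m) <= \sum_(k <= i < m) enorm (x i - x i.+1).
Proof.
elim: m => [|m IH]; first by rewrite leqn0 => /eqP ->; rewrite subrr enorm0 big_geq.
rewrite leq_eqVlt => /predU1P[->|]; first by rewrite subrr enorm0 big_geq.
rewrite ltnS => km; rewrite big_nat_recr//=.
rewrite -(subrKA (x m)); apply: le_trans (enormD _ _) _.
by rewrite lerD2r IH.
Qed.

Lemma enorm_continuous {R : realType} {n : nat} : continuous (@enorm R n).
Proof.
have edotcont : continuous (fun u : 'rV[R]_n => edot u u).
  apply: (continuous_big add_continuous) => i _ u.
  have uc := @coord_continuous R _ _ ord0 i u.
  exact: (cvgM uc uc).
by move=> u; apply: continuous_comp; [exact: edotcont|exact: sqrt_continuous].
Qed.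

(** Each coordinate is the partial sum of an absolutely convergent series of real
    numbers, because a coordinate is at most the Euclidean norm. *)
Lemma enorm_series_cvg {R : realType} {n : nat} {x : nat -> 'rV[R]_n} {S : R} :
  (forall m, \sum_(0 <= i < m) enorm (x i - x i.+1) <= S) ->
  exists l : 'rV[R]_n, x @ \oo --> l.
Proof.
move=> xS.
have xc (j : 'I_n) : cvgn (fun k => x k ord0 j).
  have -> : (fun k => x k ord0 j) =
      (fun k => x 0%N ord0 j + series (telescope (fun k => x k ord0 j)) k).
    by apply/funext => k; rewrite -eq_sum_telescope.
  apply: is_cvgD; first exact: is_cvg_cst.
  apply: normed_cvg; apply: nondecreasing_is_cvgn.
    apply: nondecreasing_series => k _ _; exact: normr_ge0.
  exists S => _ [m _ <-]; apply: le_trans (xS m); apply: ler_sum => k _.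
  apply: le_trans (le_coord_enorm _ j).
  by rewrite !mxE distrC.
exists (\row_j limn (fun k => x k ord0 j)).
apply/cvg_mx_entourageP => A entA.
apply: filter_forall => i; apply: filter_forall => j; rewrite (ord1 i) mxE.
have /cvg_app_entourageP/(_ A entA) := xc j.
apply: filterS => k Ak; exact: mem_set.
Qed.

(** * Concavity of the desingularizing function *)

(** A concave function lies below its tangents: concavity bounds phi s - phi t by
    the difference quotients of phi at t in the direction s - t with step l in
    (0, 1), whose limit at 0 is the derivative in that direction. The point s
    may be 0, where phi may have an infinite slope. *)
Lemma desingularizing_tangent {R : realType} {T : \bar R} {phi : R -> R} {s t : R} :
  desingularizing T phi -> 0 < t -> (t%:E < T)%E -> 0 <= s -> (s%:E < T)%E ->
  phi s <= phi t + derive1 phi t * (s - t).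
Proof.
move=> [_ _ _ conc /(_ t)dphi] t0 tT s0 sT.
have {dphi}[/derivable1_diffP dphi _ _] := dphi t0 tT.
have secant (l : R) : 0 < l -> l < 1 ->
    phi s - phi t <= l^-1 *: (phi (l *: (s - t) + t) - phi t).
  move=> l0 l1.
  have cE : conv (Itv01 (ltW l0) (ltW l1)) (s : convex_lmodType R^o) t =
      l *: (s - t) + t.
    by change (l * s + (1 - l) * t = l * (s - t) + t); ring.
  have := conc (Itv01 (ltW l0) (ltW l1)) s t.
  rewrite !inE => /(_ (conj s0 sT) (conj (ltW t0) tT)).
  rewrite cE convRE/= /unstable.onem.
  move=> h; rewrite /GRing.scale/= -(ler_pM2l l0) mulrA mulfV ?gt_eqF// mul1r.
  by move: h; rewrite /GRing.scale/=; lra.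
have dst : derivable phi t (s - t) by exact: diff_derivable.
have /cvg_dnbhs_at_right cvgq := dst.
have -> : derive1 phi t * (s - t) = 'D_(s - t) phi t.
  rewrite derive1E !deriveE//.
  have -> : s - t = (s - t) *: (1 : R) by rewrite /GRing.scale/= mulr1.
  by rewrite linearZ /GRing.scale/= mulr1 mulrC.
rewrite -lerBlDl.
rewrite /derive.
rewrite -(cvg_lim _ cvgq)//; apply: limr_ge; first by apply/cvg_ex; eexists; exact: cvgq.
near=> l; apply: secant; near: l.
- exact: nbhs_right_gt.
- exact: nbhs_right_lt.
Unshelve. all: by end_near.
Qed.

Lemma desingularizing_derive1_anti {R : realType} {T : \bar R} {phi : R -> R} {s t : R} :
  desingularizing T phi -> 0 < s -> s <= t -> (t%:E < T)%E ->
  derive1 phi t <= derive1 phi s.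
Proof.
move=> D s0; rewrite le_eqVlt => /predU1P[->//|st] tT.
have t0 := lt_trans s0 st.
have sT : (s%:E < T)%E by apply: le_lt_trans tT; rewrite lee_fin ltW.
have h1 := desingularizing_tangent D t0 tT (ltW s0) sT.
have h2 := desingularizing_tangent D s0 sT (ltW t0) tT.
have ts : 0 < t - s by rewrite subr_gt0.
rewrite -(ler_pM2r ts); lra.
Qed.

Lemma desingularizing_derive1_gt0 {R : realType} {T : \bar R} {phi : R -> R} {t : R} :
  desingularizing T phi -> 0 < t -> (t%:E < T)%E -> 0 < derive1 phi t.
Proof. by move=> [_ _ _ _ /(_ t)dphi] t0 tT; have [] := dphi t0 tT. Qed.

Lemma desingularizing_ge0 {R : realType} {T : \bar R} {phi : R -> R} {t : R} :
  desingularizing T phi -> 0 <= t -> (t%:E < T)%E -> 0 <= phi t.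
Proof. by move=> [phi0 _ _ _ _] t0 tT; apply: phi0. Qed.

Lemma desingularizing_mono {R : realType} {T : \bar R} {phi : R -> R} {s t : R} :
  desingularizing T phi -> 0 <= s -> s <= t -> (t%:E < T)%E -> phi s <= phi t.
Proof.
move=> D s0; rewrite le_eqVlt => /predU1P[->//|st] tT.
have t0 := le_lt_trans s0 st.
have sT : (s%:E < T)%E by apply: le_lt_trans tT; rewrite lee_fin ltW.
apply: le_trans (desingularizing_tangent D t0 tT s0 sT) _.
rewrite gerDl pmulr_rle0 ?subr_le0 ?ltW//.
exact: desingularizing_derive1_gt0 D t0 tT.
Qed.

(** * The worst case step *)

(** The longest step compatible with a sufficient decrease of the value from t to s. *)
Definition steplen {R : realType} (a t s : R) : R := Num.sqrt ((t - s) / a).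

(** The decrease from t to s forced by the KL inequality. The guard excludes s = 0, the
    level of the reference point, at which phi may have an infinite slope. *)
Definition kl_drop {R : realType} (a b : R) (phi : R -> R) (t s : R) : Prop :=
  0 < s -> 1 <= b * derive1 phi s * steplen a t s.

Definition length_bound {R : realType} (a b : R) (phi : R -> R) (t : R) : R :=
  b / a * phi t + 2 * steplen a t (sigma_wc (alpha_KL a b phi) t).

Section worst_case_step.
Context {R : realType} {T : \bar R} {phi : R -> R} {a b : R}.
Hypotheses (phiD : desingularizing T phi) (a0 : 0 < a) (b0 : 0 < b).

Local Notation sigma := (sigma_wc (alpha_KL a b phi)).
Local Notation e := (steplen a).

Lemma steplen_ge0 t s : 0 <= e t s.
Proof. exact: sqrtr_ge0. Qed.

Lemma sqr_steplen {t s : R} : s <= t -> e t s ^+ 2 = (t - s) / a.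
Proof. by move=> st; rewrite sqr_sqrtr// divr_ge0 ?subr_ge0// ltW. Qed.

Lemma le_steplen t s s' : s' <= s -> e t s <= e t s'.
Proof.
by move=> ss'; apply: ler_wsqrtr; rewrite ler_pM2r ?invr_gt0// lerD2l lerN2.
Qed.

(** The condition defining sigma is the square of the one defining [kl_drop]. *)
Lemma alpha_KLE {t s : R} : 0 < s -> s <= t -> (s%:E < T)%E ->
  ((alpha_KL a b phi s ^+ 2)^-1 <= (t - s)%:E)%E = (1 <= b * derive1 phi s * e t s).
Proof.
move=> s0 st sT; rewrite /alpha_KL gt_eqF// -EFin_expe.
have p0 := desingularizing_derive1_gt0 phiD s0 sT.
have al0 : 0 < b / Num.sqrt a * derive1 phi s by rewrite !mulr_gt0 ?invr_gt0 ?sqrtr_gt0.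
rewrite inver expf_eq0/= gt_eqF// lee_fin.
rewrite -[RHS](@ler_pXn2r _ 2)// ?nnegrE ?mulr_ge0 ?steplen_ge0 ?(ltW b0) ?(ltW p0)//.
rewrite expr1n [in RHS]exprMn sqr_steplen// -[LHS](ler_pM2l (exprn_gt0 2 al0)).
rewrite mulfV ?gt_eqF ?exprn_gt0//; congr (1 <= _).
rewrite exprMn exprMn exprVn sqr_sqrtr ?(ltW a0)// exprMn.
by ring.
Qed.

(** The default value 0 of the maximum is harmless, since [kl_drop t 0] always holds. *)
Lemma sigma_spec {t : R} : 0 <= t -> (t%:E < T)%E ->
  [/\ 0 <= sigma t, sigma t <= t & kl_drop a b phi t (sigma t)].
Proof.
move=> t0 tT; rewrite /sigma_wc /setmax; case: xgetP => [s _ [[/andP[s0 st] h] _]|_].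
  split=> // spos.
  rewrite -alpha_KLE//.
  by apply: le_lt_trans tT; rewrite lee_fin.
by split=> //; rewrite /kl_drop ltxx.
Qed.

(** This is where the maximum in the definition of sigma has to exist. For s > 0 the
    supremum m of the admissible set is positive, so phi' is continuous at m. If m were
    not admissible, 1 <= b phi' e would fail on a neighbourhood of m, which contains
    admissible points. *)
Lemma kl_drop_le_sigma {t s : R} : 0 <= s -> s <= t -> (t%:E < T)%E ->
  kl_drop a b phi t s -> s <= sigma t.
Proof.
rewrite le_eqVlt => /predU1P[<-|s0] st tT h.
  by case: (sigma_spec st tT).
rewrite /sigma_wc /setmax.
set E := [set u : R | 0 <= u <= t /\ ((alpha_KL a b phi u ^+ 2)^-1 <= _)%E].
have lT u : u <= t -> (u%:E < T)%E by move=> ut; apply: le_lt_trans tT; rewrite lee_fin.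
have Es : E s by split; [rewrite (ltW s0) st|rewrite alpha_KLE ?lT// h].
have supE : has_sup E.
  split; first by exists s.
  by exists t => u [/andP[]].
have sm : s <= sup E by apply: sup_ubound => //; case: supE.
have m0 : 0 < sup E by exact: lt_le_trans sm.
have mt : sup E <= t by apply: ge_sup; [exists s|move=> u [/andP[]]].
have Em : E (sup E).
  split; first by rewrite mt ltW.
  rewrite alpha_KLE// ?lT//.
  rewrite leNgt; apply/negP => lt1.
  have cont : b * derive1 phi u * e t u @[u --> sup E] -->
      b * derive1 phi (sup E) * e t (sup E).
    apply: cvgM.
      apply: cvgMr; case: phiD => _ _ _ _ /(_ _ m0 (lT _ mt))[_ + _]; exact.
    apply: continuous_cvg; first exact: sqrt_continuous.
    apply: cvgMl; apply: cvgB; [exact: cvg_cst|exact: cvg_id].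
  have : nbhs (sup E) [set u | b * derive1 phi u * e t u < 1].
    exact: cvgr_lt cont _ lt1.
  move=> /nbhs_ballP[d /= d0 dE].
  (* the radius is capped by sup E to keep the admissible point u positive *)
  pose d' := Num.min d (sup E).
  have d'0 : 0 < d' by rewrite lt_min d0 m0.
  have [u Eu ud] := sup_adherent d'0 supE.
  have um : u <= sup E by apply: sup_ubound => //; case: supE.
  have u0 : 0 < u.
    apply: le_lt_trans ud; by rewrite subr_ge0 /d' ge_min lexx orbT.
  have : ball (sup E) d u.
    rewrite /ball/= ger0_norm ?subr_ge0// ltrBlDl -ltrBlDr.
    by apply: le_lt_trans ud; rewrite lerD2l lerN2 /d' ge_min lexx.
  move=> /dE; apply/negP; rewrite -leNgt.
  by case: Eu => /andP[_ ut]; rewrite alpha_KLE// lT.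
case: xgetP => [m _ [_ /(_ _ Es)]//|/(_ (sup E))[]].
split=> // u Eu; apply: sup_ubound => //; case: supE => //.
Qed.

Lemma sigma_mono {t t' : R} : 0 <= t -> t <= t' -> (t'%:E < T)%E -> sigma t <= sigma t'.
Proof.
move=> t0 tt' t'T.
have tT : (t%:E < T)%E by apply: le_lt_trans t'T; rewrite lee_fin.
have [s0 st h] := sigma_spec t0 tT.
apply: kl_drop_le_sigma => //; first exact: le_trans tt'.
move=> spos; apply: le_trans (h spos) _.
rewrite ler_pM2l ?mulr_gt0//; last first.
  apply: (desingularizing_derive1_gt0 phiD spos).
  by apply: le_lt_trans tT; rewrite lee_fin.
by apply: ler_wsqrtr; rewrite ler_pM2r ?invr_gt0// lerD2r.
Qed.

(** Let q = e(t, sigma t) and p = e(t, s) >= q. Passing from s to sigma t raises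
    (b / a) phi by at least b phi'(sigma t) (p^2 - q^2), by the tangent inequality at
    sigma t, hence by (p^2 - q^2) / q >= 2 (p - q), because b phi'(sigma t) q >= 1. *)
Lemma le_length_bound {t s : R} : 0 <= s -> s <= sigma t -> 0 <= t -> (t%:E < T)%E ->
  b / a * phi s + 2 * e t s <= length_bound a b phi t.
Proof.
move=> s0 ss t0 tT; have [sg0 sgt h] := sigma_spec t0 tT.
have ba0 : 0 < b / a by rewrite divr_gt0.
have sgT : ((sigma t)%:E < T)%E by apply: le_lt_trans tT; rewrite lee_fin.
rewrite /length_bound.
apply: (@le_trans _ _ (b / a * phi (sigma t) + 2 * e t (sigma t))); last first.
  by rewrite lerD2r ler_pM2l// (desingularizing_mono phiD).
have [->//|sneq] := eqVneq s (sigma t).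
have sgpos : 0 < sigma t by apply: (le_lt_trans s0); rewrite lt_def eq_sym sneq.
have sT : (s%:E < T)%E by apply: le_lt_trans sgT; rewrite lee_fin.
have tan := desingularizing_tangent phiD sgpos sgT s0 sT.
have {h} := h sgpos.
have st := le_trans ss sgt.
have P2 := sqr_steplen st; have Q2 := sqr_steplen sgt.
have pq : e t (sigma t) <= e t s by exact: le_steplen.
have q0 := steplen_ge0 t (sigma t).
set p := e t s in P2 pq *; set q := e t (sigma t) in Q2 pq q0 *.
set D := derive1 phi (sigma t) in tan *.
move=> bDq.
have tan' : b / a * phi s <= b / a * phi (sigma t) - b * D * (p ^+ 2 - q ^+ 2).
  have -> : b / a * phi (sigma t) - b * D * (p ^+ 2 - q ^+ 2) =
     b / a * (phi (sigma t) + D * (s - sigma t)) by rewrite P2 Q2; field; rewrite gt_eqF.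
  by rewrite ler_pM2l.
suff : 2 * (p - q) <= b * D * (p ^+ 2 - q ^+ 2) by move: tan'; lra.
have qpos : 0 < q.
  rewrite lt_def q0 andbT; apply/eqP => q00; move: bDq; rewrite q00 mulr0; lra.
rewrite -(ler_pM2l qpos).
have h1 : p ^+ 2 - q ^+ 2 <= b * D * q * (p ^+ 2 - q ^+ 2).
  by rewrite ler_peMl// subr_ge0 ler_pXn2r// ?nnegrE ?steplen_ge0.
have h2 : q * (2 * (p - q)) <= p ^+ 2 - q ^+ 2.
  have := sqr_ge0 (p - q); lra.
move: h1 h2; lra.
Qed.

(** This bounds a single step about which only the decrease of f is known; the first
    step has to be kept inside the ball before the KL inequality can be used. *)
Lemma steplen_le_length_bound {t s : R} : 0 <= s -> s <= t -> (t%:E < T)%E ->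
  2 * e t s <= length_bound a b phi t.
Proof.
move=> s0 st tT; have t0 := le_trans s0 st; have [sg0 sgt h] := sigma_spec t0 tT.
have ba0 : 0 <= b / a by rewrite divr_ge0// ltW.
have [ss|ss] := leP s (sigma t).
  apply: le_trans (le_length_bound s0 ss t0 tT).
  rewrite lerDr mulr_ge0// (desingularizing_ge0 phiD)//.
  by apply: le_lt_trans tT; rewrite lee_fin.
rewrite /length_bound; apply: (@le_trans _ _ (2 * e t (sigma t))).
  by rewrite ler_pM2l// le_steplen// ltW.
by rewrite lerDr mulr_ge0// (desingularizing_ge0 phiD).
Qed.

(** With q = e(u, v) and p = e(v, w), the tangent inequality at v makes the right-hand
    side at least b phi'(v) p^2 >= p^2 / q, and p^2 / q >= 2 p - q. *)
Lemma kl_drop_two_steps {u v w : R} : 0 <= w -> w <= v -> v <= u -> (u%:E < T)%E ->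
  kl_drop a b phi u v -> 2 * e v w - e u v <= b / a * (phi v - phi w).
Proof.
move=> w0 wv vu uT h.
have vT : (v%:E < T)%E by apply: le_lt_trans uT; rewrite lee_fin.
have wT : (w%:E < T)%E by apply: le_lt_trans vT; rewrite lee_fin.
have := le_trans w0 wv; rewrite le_eqVlt => /predU1P[v0|v0].
  have -> : w = v by apply/eqP; rewrite eq_le wv -v0.
  by rewrite !subrr mulr0 /steplen subrr mul0r sqrtr0 mulr0 sub0r oppr_le0 sqrtr_ge0.
have tan := desingularizing_tangent phiD v0 vT w0 wT.
have {h} := h v0.
have P2 := sqr_steplen wv.
have q0 := steplen_ge0 u v.
set p := e v w in P2 *; set q := e u v in q0 *.
set D := derive1 phi v in tan *.
move=> bDq.
have ba0 : 0 < b / a by rewrite divr_gt0.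
have tan' : b * D * p ^+ 2 <= b / a * (phi v - phi w).
  have -> : b * D * p ^+ 2 = b / a * (D * (v - w)) by rewrite P2; field; rewrite gt_eqF.
  by rewrite ler_pM2l//; move: tan; lra.
apply: le_trans tan'.
have qpos : 0 < q.
  rewrite lt_def q0 andbT; apply/eqP => q00; move: bDq; rewrite q00 mulr0; lra.
rewrite -(ler_pM2l qpos).
have h1 : p ^+ 2 <= b * D * q * p ^+ 2 by rewrite ler_peMl// sqr_ge0.
have h2 : q * (2 * p - q) <= p ^+ 2 by have := sqr_ge0 (p - q); lra.
move: h1 h2; lra.
Qed.

(** The last step is counted twice on the left so that the induction closes: each
    application of [kl_drop_two_steps] adds 2 e_(N+1) - e_N. *)
Lemma sum_steplen_telescope {r : nat -> R} {N : nat} : ((r 0%N)%:E < T)%E ->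
  (forall i, (i <= N)%N -> r i.+1 <= r i /\ 0 <= r i.+1) ->
  (forall i, (i < N)%N -> kl_drop a b phi (r i) (r i.+1)) ->
  \sum_(0 <= i < N.+1) e (r i) (r i.+1) + e (r N) (r N.+1) <=
    b / a * (phi (r 1%N) - phi (r N.+1)) + 2 * e (r 0%N) (r 1%N).
Proof.
move=> r0T; elim: N => [|N IH] rd rk.
  by rewrite big_nat1 subrr mulr0 add0r; lra.
have rT i : (i <= N.+2)%N -> ((r i)%:E < T)%E.
  elim: i => [//|i IHi] iN; apply: le_lt_trans (IHi (ltnW iN)).
  by rewrite lee_fin; case: (rd i).
rewrite big_nat_recr//=.
have {}IH := IH (fun i iN => rd i (leqW iN)) (fun i iN => rk i (leqW iN)).
have [vu _] := rd N (leqnSn N).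
have [wv w0] := rd N.+1 (leqnn _).
have := kl_drop_two_steps w0 wv vu (rT N (leqW (leqnSn N))) (rk N (leqnn _)).
move: IH; lra.
Qed.

(** There is one more step in the sum than there are hypotheses [kl_drop]: the length
    of the step N is controlled before the KL inequality is known for it. *)
Lemma sum_steplen_le {r : nat -> R} {N : nat} : ((r 0%N)%:E < T)%E ->
  (forall i, (i <= N)%N -> r i.+1 <= r i /\ 0 <= r i.+1) ->
  (forall i, (i < N)%N -> kl_drop a b phi (r i) (r i.+1)) ->
  \sum_(0 <= i < N.+1) e (r i) (r i.+1) <= length_bound a b phi (r 0%N).
Proof.
move=> r0T rd rk.
have [r10 r1] := rd 0%N (leq0n _).
case: N rd rk => [|N] rd rk.
  rewrite big_nat1; apply: le_trans (steplen_le_length_bound r1 r10 r0T).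
  by have := steplen_ge0 (r 0%N) (r 1%N); lra.
have tele := sum_steplen_telescope r0T rd rk.
have r1s := kl_drop_le_sigma r1 r10 r0T (rk 0%N (ltn0Sn _)).
have := le_length_bound r1 r1s (le_trans r1 r10) r0T.
have rT i : (i <= N.+2)%N -> ((r i)%:E < T)%E.
  elim: i => [//|i IHi] iN; apply: le_lt_trans (IHi (ltnW iN)).
  by rewrite lee_fin; case: (rd i).
have [_ rN0] := rd N.+1 (leqnn _).
have phiN : 0 <= phi (r N.+2) := desingularizing_ge0 phiD rN0 (rT _ (leqnn _)).
have ba0 : 0 <= b / a by rewrite divr_ge0// ltW.
have := mulr_ge0 ba0 phiN.
have := steplen_ge0 (r N.+1) (r N.+2).
move: tele; lra.
Qed.

(** If r stayed above eps, all the steps would be at least (b phi'(eps))^-1, since phi'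
    is non-increasing, and their sum would exceed [length_bound]. *)
Lemma kl_drop_vanish {r : nat -> R} : ((r 0%N)%:E < T)%E ->
  (forall i, r i.+1 <= r i /\ 0 <= r i.+1) ->
  (forall i, kl_drop a b phi (r i) (r i.+1)) ->
  forall eps : R, 0 < eps -> exists k, r k < eps.
Proof.
move=> r0T rd rk eps eps0; apply/not_existsP => rge.
have {}rge k : eps <= r k by rewrite leNgt; exact/negP/rge.
have epsT : (eps%:E < T)%E by apply: le_lt_trans r0T; rewrite lee_fin.
have rT i : ((r i)%:E < T)%E.
  by elim: i => [//|i IHi]; apply: le_lt_trans IHi; rewrite lee_fin; case: (rd i).
have c0 : 0 < b * derive1 phi eps.
  by rewrite mulr_gt0// (desingularizing_derive1_gt0 phiD).
have step i : (b * derive1 phi eps)^-1 <= e (r i) (r i.+1).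
  rewrite -(ler_pM2l c0) mulfV ?gt_eqF//.
  apply: le_trans (rk i (lt_le_trans eps0 (rge _))) _.
  rewrite ler_wpM2r ?steplen_ge0// ler_pM2l//.
  exact: desingularizing_derive1_anti phiD eps0 (rge _) (rT _).
pose M := length_bound a b phi (r 0%N).
have [m mM] : exists m : nat, M * (b * derive1 phi eps) < m%:R.
  by exists (Num.truncn (M * (b * derive1 phi eps))).+1; exact: truncnS_gt.
have := sum_steplen_le (N := m) r0T (fun i _ => rd i) (fun i _ => rk i).
apply/negP; rewrite -ltNge -/M.
apply: (@lt_le_trans _ _ (\sum_(0 <= i < m.+1) (b * derive1 phi eps)^-1)); last first.
  by apply: ler_sum.
rewrite sumr_const_nat subn0 -mulr_natl ltr_pdivlMr//.
by apply: lt_trans mM _; rewrite ltr_nat.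
Qed.

End worst_case_step.

(** * From the KL inequality to the real sequence of gaps *)

(** The values of f met in the proof lie between f xstar and eta, so that the
    extended-real inequalities may be read on the gaps. *)
Lemma level_fin {R : realType} {n : nat} {f : 'rV[R]_n -> \bar R} {xstar z : 'rV[R]_n}
    {eta : \bar R} :
  f xstar \is a fin_num -> (f xstar <= f z)%E -> (f z < eta)%E -> f z \is a fin_num.
Proof.
by case: (f xstar) => // c _; case: (f z) => // _; rewrite ltNge leey.
Qed.

Lemma gapE {R : realType} {n : nat} {f : 'rV[R]_n -> \bar R} {xstar z : 'rV[R]_n} :
  f xstar \is a fin_num -> f z \is a fin_num ->
  (f z - f xstar)%E = (gap f xstar z)%:E.
Proof. by move=> cfin zfin; rewrite /gap fineK// fin_numB zfin cfin. Qed.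

Lemma gapB {R : realType} {n : nat} {f : 'rV[R]_n -> \bar R} {xstar z w : 'rV[R]_n} :
  f xstar \is a fin_num -> f z \is a fin_num -> f w \is a fin_num ->
  (f z - f w)%E = (gap f xstar z - gap f xstar w)%:E.
Proof.
by rewrite /gap; case: (f xstar) => // c; case: (f z) => // u; case: (f w) => // v _ _ _;
  rewrite -!EFinB; congr EFin => /=; ring.
Qed.

Lemma le_gap {R : realType} {n : nat} {f : 'rV[R]_n -> \bar R} {xstar z w : 'rV[R]_n} :
  f xstar \is a fin_num -> f z \is a fin_num -> f w \is a fin_num ->
  (gap f xstar z <= gap f xstar w) = (f z <= f w)%E.
Proof.
by move=> cf zf wf; rewrite -subr_ge0 -lee_fin -gapB// sube_ge0 ?zf.
Qed.

Lemma gap_ge0 {R : realType} {n : nat} {f : 'rV[R]_n -> \bar R} {xstar z : 'rV[R]_n} :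
  f xstar \is a fin_num -> f z \is a fin_num -> (f xstar <= f z)%E -> 0 <= gap f xstar z.
Proof. by move=> cf zf cz; rewrite -lee_fin -gapE// sube_ge0 ?cf. Qed.

Lemma gap_lt {R : realType} {n : nat} {f : 'rV[R]_n -> \bar R} {xstar z : 'rV[R]_n}
    {eta : \bar R} :
  f xstar \is a fin_num -> f z \is a fin_num -> (f z < eta)%E ->
  ((gap f xstar z)%:E < eta - f xstar)%E.
Proof. by move=> cf zf cz; rewrite -gapE// lteBlDr// subeK. Qed.

Lemma dist0_ge0 {R : realType} {n : nat} (A : set 'rV[R]_n) : (0 <= dist0 A)%E.
Proof. by apply: le_ereal_inf_tmp => _ [z _ <-]; rewrite lee_fin enorm_ge0. Qed.

Section descent.
Context {R : realType} {n : nat} {f : 'rV[R]_n -> \bar R} {xstar : 'rV[R]_n}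
  {delta : R} {eta : \bar R} {phi : R -> R} {a b : R}.
Hypotheses (f_KL : KL_inequality f xstar delta eta phi) (a_gt0 : 0 < a) (b_gt0 : 0 < b).

Local Notation gap := (gap f xstar).

Lemma enorm_le_steplen {z w : 'rV[R]_n} :
  (f xstar <= f z)%E -> (f z < eta)%E -> (f xstar <= f w)%E -> (f w < eta)%E ->
  (f w + (a * enorm (w - z) ^+ 2)%:E <= f z)%E ->
  enorm (z - w) <= steplen a (gap z) (gap w).
Proof.
case: f_KL => cf _ _ _ cz zeta cw weta.
have zf := level_fin cf cz zeta; have wf := level_fin cf cw weta.
rewrite addeC -leeBrDr// (gapB cf)// lee_fin => h.
have wz : gap w <= gap z.
  by rewrite -subr_ge0; apply: le_trans h; rewrite mulr_ge0 ?sqr_ge0// ltW.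
rewrite -(@ler_pXn2r _ 2)// ?nnegrE ?enorm_ge0 ?steplen_ge0//.
by rewrite sqr_steplen// enormB ler_pdivlMr// mulrC.
Qed.

(** The relative error condition bounds dist(subdiff f y, 0) by b e(gap z, gap w), and
    the KL inequality at y bounds it below by 1 / phi'(gap y) >= 1 / phi'(gap w). *)
Lemma KL_inequality_drop {z w y : 'rV[R]_n} :
  (f z < eta)%E -> (f xstar <= f w)%E -> (f w <= f y)%E -> (f y <= f z)%E ->
  ((a / b ^+ 2)%:E * dist0 (limiting_subdiff f y) ^+ 2 <= f z - f w)%E ->
  eball xstar delta y -> kl_drop a b phi (gap z) (gap w).
Proof.
case: f_KL => cf _ phiD KL zeta cw wy yz dist_le yball w0.
have yeta := le_lt_trans yz zeta; have cy := le_trans cw wy.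
have wf := level_fin cf cw (le_lt_trans wy yeta).
have yf := level_fin cf cy yeta; have zf := level_fin cf (le_trans cy yz) zeta.
have cy' : (f xstar < f y)%E.
  by apply: lt_le_trans wy; rewrite -sube_gt0 gapE// lte_fin.
have gwy : gap w <= gap y by rewrite le_gap.
have gwz : gap w <= gap z by rewrite le_gap// (le_trans wy).
have yT := gap_lt cf yf yeta.
have := KL y yball cy' yeta.
have := dist0_ge0 (limiting_subdiff f y).
have ab0 : 0 < a / b ^+ 2 by rewrite divr_gt0 ?exprn_gt0.
rewrite (gapB cf zf wf) in dist_le.
case: (dist0 _) dist_le => [d| |]//; last first.
  by rewrite expe2 mulyy gt0_muley ?lte_fin// leye_eq.
rewrite -EFin_expe -!EFinM !lee_fin => dist_le d0 KLy.
have d_le : d <= b * steplen a (gap z) (gap w).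
  rewrite -(@ler_pXn2r _ 2)// ?nnegrE ?mulr_ge0 ?steplen_ge0 ?(ltW b_gt0)//.
  rewrite exprMn sqr_steplen// mulrA ler_pdivlMr//.
  rewrite mulrC -ler_pdivrMl ?exprn_gt0//.
  by apply: le_trans dist_le; rewrite le_eqVlt; apply/orP; left; apply/eqP; ring.
apply: le_trans KLy _; rewrite mulrAC mulrC; apply: ler_pM => //.
  by rewrite ltW// (desingularizing_derive1_gt0 phiD)// (lt_le_trans w0).
exact: desingularizing_derive1_anti phiD w0 gwy yT.
Qed.

End descent.

(** * Convergence *)

Theorem proposition5p1 (R : realType) (n : nat) (f : 'rV[R]_n -> \bar R)
    (xstar : 'rV[R]_n) (delta : R) (eta : \bar R) (phi : R -> R)
    (a b : R) (x : nat -> 'rV[R]_n)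
    (f_proper : proper_function f)
    (f_lsc : lower_semicontinuous f)
    (f_KL : KL_inequality f xstar delta eta phi)
    (a_gt0 : 0 < a) (b_gt0 : 0 < b)
    (descent : forall k : nat,
      (f (x k.+1) + (a * enorm (x k.+1 - x k) ^+ 2)%:E <= f (x k))%E)
    (intermediate : forall k : nat, exists y : 'rV[R]_n,
      [/\ limiting_subdiff f y !=set0,
          ((a / b ^+ 2)%:E * dist0 (limiting_subdiff f y) ^+ 2
             <= f (x k) - f (x k.+1))%E,
          (f (x k.+1) <= f y)%E
        & (f y <= f (x k) - (a * enorm (y - x k) ^+ 2)%:E)%E])
    (x0_level : (f xstar <= f (x 0%N))%E /\ (f (x 0%N) < eta)%E)
    (x_level : forall k : nat,
      eball xstar delta (x k) -> (f xstar <= f (x k.+1))%E)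
    (x0_close :
      let sigma := sigma_wc (alpha_KL a b phi) in
      let r0 := gap f xstar (x 0%N) in
      b / a * phi r0 + 2 * Num.sqrt ((r0 - sigma r0) / a)
        + enorm (x 0%N - xstar) < delta) :
  let sigma := sigma_wc (alpha_KL a b phi) in
  (forall k : nat, eball xstar delta (x k)) /\
  exists xlim : 'rV[R]_n,
    [/\ x @ \oo --> xlim,
        (f xlim <= f xstar)%E,
        forall k : nat,
          (f (x k) - f xstar <= (iter k sigma (gap f xstar (x 0%N)))%:E)%E
      & forall k : nat,
          let rk := gap f xstar (x k) in
          ((enorm (x k - xlim))%:E
             <= \sum_(k <= i <oo) (enorm (x i - x i.+1))%:E)%E /\
          (\sum_(k <= i <oo) (enorm (x i - x i.+1))%:E
             <= (b / a * phi rk + 2 * Num.sqrt ((rk - sigma rk) / a))%:E)%E].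
Proof.
have [cf _ phiD _] := f_KL.
have [c0 eta0] := x0_level.
have sq0 (v : 'rV[R]_n) : 0 <= a * enorm v ^+ 2 by rewrite mulr_ge0 ?sqr_ge0// ltW.
have fdec k : (f (x k.+1) <= f (x k))%E.
  by apply: le_trans (descent k); rewrite leeDl// lee_fin.
have feta k : (f (x k) < eta)%E by elim: k => [//|k]; apply: le_lt_trans.
set r := fun k => gap f xstar (x k).
have r0T : ((r 0%N)%:E < eta - f xstar)%E.
  by apply: gap_lt => //; exact: level_fin c0 eta0.
set e := fun i => steplen a (r i) (r i.+1).
have close : length_bound a b phi (r 0%N) + enorm (x 0%N - xstar) < delta by [].
have x0ball : eball xstar delta (x 0%N).
  apply: le_lt_trans close; rewrite lerDr.
  have r00 : 0 <= r 0%N by apply: gap_ge0 => //; exact: level_fin c0 eta0.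
  by apply: le_trans (steplen_le_length_bound phiD a_gt0 b_gt0 (lexx 0) r00 r0T);
    rewrite mulr_ge0// steplen_ge0.
(* simultaneous induction: the ball gives the KL inequality at the next step, which
   in turn keeps the following points in the ball *)
have main k : (forall i, (i <= k)%N -> eball xstar delta (x i)) /\
    (forall i, (i < k)%N -> kl_drop a b phi (r i) (r i.+1)).
  elim: k => [|k [IHball IHdrop]].
    by split=> [i|//]; rewrite leqn0 => /eqP ->.
  have lvl i : (i <= k.+1)%N -> (f xstar <= f (x i))%E.
    by case: i => [//|i] ik; apply: x_level; exact: IHball.
  have fin i (ik : (i <= k.+1)%N) := level_fin cf (lvl i ik) (feta i).
  have rd i : (i <= k)%N -> r i.+1 <= r i /\ 0 <= r i.+1.
    move=> ik; split; last by apply: gap_ge0 => //; [exact: fin|exact: lvl].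
    by rewrite le_gap ?fin// ?leqW// fdec.
  have budget := sum_steplen_le phiD a_gt0 b_gt0 r0T rd IHdrop.
  (* this applies both to the intermediate point and to x k.+1 *)
  have near_ball z : (f (x k.+1) <= f z)%E ->
      (f z + (a * enorm (z - x k) ^+ 2)%:E <= f (x k))%E -> eball xstar delta z.
    move=> xz zx.
    have zle : (f z <= f (x k))%E by apply: le_trans zx; rewrite leeDl// lee_fin.
    have cz := le_trans (lvl k.+1 (leqnn _)) xz.
    have zeta := le_lt_trans zle (feta k).
    have := enorm_le_steplen f_KL a_gt0 (lvl k (leqnSn _)) (feta k) cz zeta zx.
    have zf := level_fin cf cz zeta.
    have : gap f xstar (x k.+1) <= gap f xstar z by rewrite le_gap ?fin.
    move=> /(le_steplen a_gt0 (r k)) e1 e2.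
    have {}e1 := le_trans e2 e1.
    apply: le_lt_trans close.
    have -> : z - xstar = (z - x k) + ((x k - x 0%N) + (x 0%N - xstar)).
      by rewrite !addrA subrK subrK.
    apply: le_trans (enormD _ _) _; rewrite enormB.
    apply: le_trans (lerD e1 (enormD _ _)) _; rewrite addrA lerD2r.
    apply: le_trans budget; rewrite big_nat_recr//= addrC lerD2r enormB.
    apply: le_trans (enorm_path x (leq0n k)) _.
    apply: ler_sum_nat => i /andP[_ ik].
    have [ik1 ik2] : (i <= k.+1)%N /\ (i.+1 <= k.+1)%N.
      by split; [exact: leqW (ltnW ik)|exact: leqW].
    exact: (enorm_le_steplen f_KL a_gt0 (lvl _ ik1) (feta i) (lvl _ ik2)
      (feta i.+1) (descent i)).
  have xball : eball xstar delta (x k.+1) by exact: near_ball.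
  split=> i; rewrite leq_eqVlt => /predU1P[|]; rewrite ?ltnS.
  - by move=> ->.
  - exact: IHball.
  - move=> [->]; have [y [_ ydist xy yx]] := intermediate k.
    rewrite leeBrDr// in yx.
    have yx' : (f y <= f (x k))%E by apply: le_trans yx; rewrite leeDl// lee_fin.
    have yball := near_ball y xy yx.
    exact: (KL_inequality_drop f_KL a_gt0 b_gt0 (feta k) (lvl _ (leqnn _)) xy yx').
  - exact: IHdrop.
have ball k : eball xstar delta (x k) by have [+ _] := main k; apply.
have drop k : kl_drop a b phi (r k) (r k.+1) by have [_] := main k.+1; apply.
have lvl k : (f xstar <= f (x k))%E by case: k => [//|k]; exact: x_level.
have fin k := level_fin cf (lvl k) (feta k).
have rd k : r k.+1 <= r k /\ 0 <= r k.+1.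
  by split; [rewrite le_gap|apply: gap_ge0].
have r_ge0 k : 0 <= r k by apply: gap_ge0.
have rT k : ((r k)%:E < eta - f xstar)%E by exact: gap_lt.
have step k : enorm (x k - x k.+1) <= e k.
  exact: (enorm_le_steplen f_KL a_gt0 (lvl k) (feta k) (lvl k.+1) (feta k.+1) (descent k)).
(* the length bound for the sequence restarted at x k *)
have tail k m : \sum_(k <= i < m) enorm (x i - x i.+1) <= length_bound a b phi (r k).
  have := @sum_steplen_le _ _ _ _ _ phiD a_gt0 b_gt0 (fun i => r (k + i)%N) (m - k).
  rewrite addn0 => /(_ (rT k)) budget.
  apply: (@le_trans _ _ (\sum_(0 <= i < (m - k).+1) e (k + i)%N)); last first.
    under eq_bigr do rewrite /e -addnS.
    by apply: budget => i _; rewrite addnS.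
  rewrite -{1}[k]add0n big_addn big_nat_recr//=.
  rewrite -[leLHS]addr0 lerD ?steplen_ge0//.
  by apply: ler_sum => i _; rewrite addnC; exact: step.
move=> sigma; split=> //.
have [xlim xcvg] := enorm_series_cvg (tail 0%N).
exists xlim; split=> //.
- rewrite leNgt; apply/negP => lim_gt.
  (* f xlim may be +oo, whence the choice of a real level in between *)
  have [d d0 dlt] : exists2 d : R, 0 < d & (f xstar + d%:E < f xlim)%E.
    have : (0 < f xlim - f xstar)%E by rewrite sube_gt0.
    case fl : (f xlim) lim_gt => [u| |]//.
    + rewrite -(fineK cf) lte_fin => cu _; exists ((u - fine (f xstar)) / 2).
        by rewrite divr_gt0// subr_gt0.
      by rewrite -EFinD lte_fin; lra.
    + by move=> _ _; exists 1 => //; rewrite -(fineK cf) -EFinD ltry.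
  rewrite -(fineK cf) -EFinD in dlt.
  have [V Vlim Vgt] := f_lsc _ _ dlt.
  have [N _ xV] := xcvg _ Vlim.
  have [k rk] := kl_drop_vanish phiD a_gt0 b_gt0 r0T rd drop _ d0.
  have rmono m : r (k + m)%N <= r k.
    elim: m => [|m]; first by rewrite addn0.
    by rewrite addnS; apply: le_trans; have [] := rd (k + m)%N.
  have := Vgt _ (xV (k + N)%N (leq_addl _ _)).
  rewrite EFinD fineK// addeC -lteBrDr// gapE// lte_fin.
  by have := rmono N; rewrite /r; move: rk; rewrite /r; lra.
- move=> k; rewrite gapE// lee_fin -/(r k) -/(r 0%N).
  have iter_le : r k <= iter k sigma (r 0%N) <= r 0%N.
    elim: k => [|k /andP[IH1 IH2]]; first by rewrite lexx.
    have iT : ((iter k sigma (r 0%N))%:E < eta - f xstar)%E.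
      by apply: le_lt_trans r0T; rewrite lee_fin.
    have i0 := le_trans (r_ge0 k) IH1.
    have [rk1 rk2] := rd k.
    have h1 := kl_drop_le_sigma phiD a_gt0 b_gt0 rk2 rk1 (rT k) (drop k).
    have h2 := sigma_mono phiD a_gt0 b_gt0 (r_ge0 k) IH1 iT.
    have [_ h3 _] := sigma_spec phiD a_gt0 b_gt0 i0 iT.
    by rewrite iterS (le_trans h1 h2) (le_trans h3 IH2).
  by case/andP: iter_le.
- move=> k rk.
  have nn i : (k <= i)%N -> true -> (0 <= (enorm (x i - x i.+1))%:E)%E.
    by move=> _ _; rewrite lee_fin enorm_ge0.
  split; last first.
    apply: lime_le; first exact: is_cvg_nneseries.
    by apply: nearW => m; rewrite sumEFin lee_fin; exact: tail.
  have ncvg : enorm (x k - x m) @[m --> \oo] --> enorm (x k - xlim).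
    have xk : x k - x m @[m --> \oo] --> x k - xlim.
      by apply: cvgB => //; exact: cvg_cst.
    exact: (cvg_comp _ _ xk (enorm_continuous (x k - xlim))).
  have ecvg : (enorm (x k - x m))%:E @[m --> \oo] --> (enorm (x k - xlim))%:E.
    by apply: cvg_EFin => //; exact: nearW.
  rewrite -(cvg_lim _ ecvg)//; apply: lime_le.
    by apply/cvg_ex; eexists; exact: ecvg.
  exists k => // m /= km.
  apply: le_trans (nneseries_lim_ge m nn).
  by rewrite sumEFin lee_fin enorm_path.
Qed.
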